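(* For all $0 < t < \infty$, $$\frac{6 - 10^{-20}}{t^2} > 3Q(t)^2.$$
   Context: $Q(t)$, $t\ge 0$, denotes the radial profile of the positive radial ground state of $\Delta\phi - \phi + |\phi|^2\phi = 0$ on $\mathbb{R}^3$; it solves $-Q'' - \frac{2}{t}Q' + Q - Q^3 = 0$. *)

(* Defs.v *)
From Stdlib Require Import Reals.
From Coquelicot Require Import Coquelicot.
Open Scope R_scope.

(* Q is the radial profile of the positive radial ground state of
   Delta phi - phi + |phi|^2 phi = 0 on R^3, i.e. phi(x) = Q(|x|).
   We represent Q as a function R -> R, namely its even extension
   (Q(-t) = Q(t)); smoothness of phi makes this extension C^2 on R.
   Characterizing properties:
   - Q is positive;
   - Q is twice differentiable everywhere (even extension, regular at 0);
   - Q solves -Q'' - (2/t) Q' + Q - Q^3 = 0 for t > 0;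
   - Q(t) -> 0 as t -> +oo (the ground state lies in H^1).
   By the uniqueness theorem (Coffman, Kwong) these determine Q. *)
Definition is_ground_state_profile (Q : R -> R) : Prop :=
  (forall t, Q (- t) = Q t) /\
  (forall t, 0 < Q t) /\
  (forall t, ex_derive Q t) /\
  (forall t, ex_derive (Derive Q) t) /\
  (forall t, 0 < t ->
     - Derive (Derive Q) t - (2 / t) * Derive Q t + Q t - (Q t) ^ 3 = 0) /\
  is_lim Q p_infty 0.

(* Main.v *)
Require Import Defs.
From Stdlib Require Import Reals Lra Classical.
From Coquelicot Require Import Coquelicot.
Open Scope R_scope.

(** Put [u = t Q], so that [u'' = u (1 - Q^2)].  The energies
    [Q'^2/2 - Q^2/2 + Q^4/4] and [H = u'^2/2 - u^2/2 + u^4/(4 t^2)] are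
    nonincreasing, and both are nonnegative since [u] gets arbitrarily small at
    infinity.  The first forces [Q' < 0]; the second forces [u^2 > 2 t^2], hence
    [u'' < 0], at every critical point of [u], so [u] increases up to a
    single maximum at some [t0] and decreases afterwards.

    In the variables [x = u^2], [tau = t^2], [z = - t Q' / Q] and the time
    [s = ln t] the equation becomes the autonomous system
    [dx/ds = 2 x (1 - z)], [dz/ds = x - tau - z + z^2], [dtau/ds = 2 tau], and
    regularity at [t = 0] means that the orbit emanates from the origin.  While
    [0 <= z <= 1], i.e. up to [t0], such an orbit stays in [x <= X(z, tau)] for an
    explicit cubic [X].  At [t0] one has [z = 1], which gives
    [u^2 <= 7/5 + tau/2], whereas [H > 0] gives [tau < u^2 / 2];
    hence [u^2 < 28/15 < 2]. *)

(** * Calculus on the line *)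

Lemma ex_derive_increment (f : R -> R) (a b : R) :
  a < b -> (forall t, ex_derive f t) ->
  exists c, f b - f a = Derive f c * (b - a) /\ a < c < b.
Proof.
  intros ab df.
  apply (MVT_cor2 f (Derive f) a b ab).
  intros c _; apply is_derive_Reals, Derive_correct, df.
Qed.

Lemma le_of_Derive_ge0 (f : R -> R) (a b : R) :
  a <= b -> (forall t, ex_derive f t) ->
  (forall t, a < t < b -> 0 <= Derive f t) -> f a <= f b.
Proof.
  intros [ab | <-] df pos; [|lra].
  destruct (ex_derive_increment f a b ab df) as [c [Ec Hc]].
  specialize (pos c Hc); nra.
Qed.

Lemma lt_of_Derive_gt0 (f : R -> R) (a b : R) :
  a < b -> (forall t, ex_derive f t) ->
  (forall t, a < t < b -> 0 < Derive f t) -> f a < f b.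
Proof.
  intros ab df pos.
  destruct (ex_derive_increment f a b ab df) as [c [Ec Hc]].
  specialize (pos c Hc); nra.
Qed.

Lemma Derive_lt0_locally (g : R -> R) (a : R) :
  ex_derive g a -> Derive g a < 0 ->
  exists d, 0 < d /\
    (forall t, a < t < a + d -> g t < g a) /\
    (forall t, a - d < t < a -> g a < g t).
Proof.
  intros dg neg.
  assert (D : derivable_pt_lim g a (Derive g a))
    by (apply is_derive_Reals, Derive_correct, dg).
  destruct (D (- Derive g a)) as [d Hd]; [lra|].
  exists d; split; [apply cond_pos|].
  assert (K : forall h, h <> 0 -> Rabs h < d -> (g (a + h) - g a) / h < 0).
  { intros h h0 hd; specialize (Hd h h0 hd).
    apply Rabs_def2 in Hd; lra. }
  assert (E : forall h, h <> 0 -> g (a + h) - g a = (g (a + h) - g a) / h * h)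
    by (intros; field; assumption).
  split; intros t Ht.
  - assert (h0 : t - a <> 0) by lra.
    assert (hd : Rabs (t - a) < d) by (apply Rabs_def1; lra).
    specialize (K _ h0 hd); specialize (E _ h0).
    replace (a + (t - a)) with t in * by ring; nra.
  - assert (h0 : t - a <> 0) by lra.
    assert (hd : Rabs (t - a) < d) by (apply Rabs_def1; lra).
    specialize (K _ h0 hd); specialize (E _ h0).
    replace (a + (t - a)) with t in * by ring; nra.
Qed.

(** The sign condition at zeros only allows [g] to cross zero downwards, so a nonpositive start can
    never lead back up to zero. *)
Lemma neg_persists (g : R -> R) (a : R) :
  (forall t, ex_derive g t) ->
  (forall t, a <= t -> g t = 0 -> Derive g t < 0) ->
  g a <= 0 -> forall t, a < t -> g t < 0.
Proof.
  intros dg zero ga t1 at1.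
  destruct (Rlt_or_le (g t1) 0) as [|gt1]; [assumption|exfalso].
  (* A start with [g a = 0] is moved slightly to the right, where [g] is strictly negative; the
     supremum below needs a strict start. *)
  assert (start : exists a', a <= a' < t1 /\ g a' < 0).
  { destruct ga as [ga | ga]; [exists a; lra|].
    destruct (Derive_lt0_locally g a (dg a) (zero a (Rle_refl a) ga))
      as [d [d0 [right _]]].
    exists (a + Rmin d (t1 - a) / 2).
    assert (M := Rmin_l d (t1 - a)); assert (M' := Rmin_r d (t1 - a)).
    assert (0 < Rmin d (t1 - a)) by (apply Rmin_pos; lra).
    split; [lra|]; rewrite <- ga; apply right; lra. }
  destruct start as [a' [aa' ga']].
  set (S := fun t => a' <= t <= t1 /\ forall r, a' <= r <= t -> g r < 0).
  destruct (completeness S) as [s [ub lub]].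
  { exists t1; intros t [Ht _]; lra. }
  { exists a'; split; [lra|]; intros r Hr; replace r with a' by lra; assumption. }
  assert (s_ge : a' <= s).
  { apply ub; split; [lra|]; intros r Hr; replace r with a' by lra; assumption. }
  assert (s_le : s <= t1) by (apply lub; intros t [Ht _]; lra).
  assert (before : forall r, a' <= r < s -> g r < 0).
  { intros r Hr.
    destruct (Rlt_or_le (g r) 0) as [|gr]; [assumption|exfalso].
    assert (s <= r); [|lra].
    apply lub; intros t [Ht neg].
    destruct (Rle_or_lt t r) as [|rt]; [assumption|].
    assert (g r < 0) by (apply neg; lra); lra. }
  assert (cg : continuity_pt g s)
    by (apply continuity_pt_filterlim; apply (ex_derive_continuous g s (dg s))).
  (* At the end [s] of the maximal interval of negativity no sign is possible: if [g s < 0] the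
     interval extends, if [g s = 0] then [g] is positive just before [s], and if [g s > 0] the same
     follows by continuity. *)
  destruct (Rtotal_order (g s) 0) as [gs | [gs | gs]].
  - assert (st1 : s < t1).
    { destruct s_le as [|Es]; [assumption|]; rewrite Es in gs; lra. }
    destruct (cg (- g s)) as [d [d0 Hd]]; [lra|].
    set (e := Rmin d (t1 - s) / 2).
    assert (M := Rmin_l d (t1 - s)); assert (M' := Rmin_r d (t1 - s)).
    assert (0 < Rmin d (t1 - s)) by (apply Rmin_pos; lra).
    assert (s + e <= s); [|unfold e in *; lra].
    apply ub; split; [unfold e; lra|].
    intros r Hr.
    destruct (Rlt_or_le r s) as [rs | [sr | <-]];
      [apply before; lra | | assumption].
    assert (Rabs (g r - g s) < - g s).
    { apply Hd; split; [split; [exact I|lra]|].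
      simpl; unfold R_dist; apply Rabs_def1; unfold e in Hr; lra. }
    apply Rabs_def2 in H0; lra.
  - assert (a's : a' < s).
    { destruct s_ge as [|Es]; [assumption|]; rewrite Es in ga'; lra. }
    destruct (Derive_lt0_locally g s (dg s)) as [d [d0 [_ left]]].
    { apply zero; lra. }
    set (r := Rmax a' (s - d / 2)).
    assert (M := Rmax_l a' (s - d / 2)); assert (M' := Rmax_r a' (s - d / 2)).
    assert (rs : r < s) by (apply Rmax_lub_lt; lra).
    assert (g s < g r) by (apply left; unfold r in *; lra).
    assert (g r < 0) by (apply before; unfold r in *; lra).
    lra.
  - destruct (cg (g s)) as [d [d0 Hd]]; [lra|].
    assert (a's : a' < s).
    { destruct s_ge as [|Es]; [assumption|]; rewrite Es in ga'; lra. }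
    set (r := Rmax a' (s - d / 2)).
    assert (M := Rmax_l a' (s - d / 2)); assert (M' := Rmax_r a' (s - d / 2)).
    assert (rs : r < s) by (apply Rmax_lub_lt; lra).
    assert (g r < 0) by (apply before; unfold r in *; lra).
    assert (Rabs (g r - g s) < g s).
    { apply Hd; split; [split; [exact I|lra]|].
      simpl; unfold R_dist; apply Rabs_def1; unfold r in *; lra. }
    apply Rabs_def2 in H0; lra.
Qed.

(** The integrating factor [exp (- K)], with [K] a primitive of [k], turns the inequality into
    monotonicity of [F * exp (- K)], which vanishes at 0. *)
Lemma linear_gronwall_ge0 (F k : R -> R) (b : R) :
  0 <= b -> F 0 = 0 -> (forall t, ex_derive F t) -> (forall t, continuous k t) ->
  (forall t, 0 < t < b -> k t * F t <= Derive F t) -> 0 <= F b.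
Proof.
  intros b0 F0 dF ck ineq.
  set (K := fun t => RInt k 0 t).
  assert (dK : forall t, is_derive K t (k t)).
  { intros t; apply is_derive_RInt with (a := 0); [|apply ck].
    apply filter_forall; intros x.
    apply (RInt_correct (V := R_CompleteNormedModule)).
    apply ex_RInt_continuous; intros; apply ck. }
  set (G := fun t => F t * exp (- K t)).
  assert (dG : forall t, is_derive G t ((Derive F t - k t * F t) * exp (- K t))).
  { intros t; unfold G; auto_derive.
    - split; [apply dF|]; split; [exists (k t); apply dK | exact I].
    - change (Derive (fun x => K x) t) with (Derive K t).
      change (Derive (fun x => F x) t) with (Derive F t).
      rewrite (is_derive_unique K t _ (dK t)); ring. }
  assert (le : G 0 <= G b).
  { apply le_of_Derive_ge0; [assumption| |].
    - intros t; eexists; apply dG.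
    - intros t Ht; rewrite (is_derive_unique _ _ _ (dG t)).
      specialize (ineq t Ht); assert (E := exp_pos (- K t)); nra. }
  unfold G in le; rewrite F0 in le.
  assert (E := exp_pos (- K b)); nra.
Qed.

(** * Energies of the profile *)

Lemma profile_ode (Q : R -> R) :
  is_ground_state_profile Q -> forall t, 0 < t ->
  Derive (Derive Q) t = Q t - Q t ^ 3 - 2 / t * Derive Q t.
Proof. intros (_ & _ & _ & _ & ode & _) t t0; specialize (ode t t0); lra. Qed.

Lemma profile_Derive_0 (Q : R -> R) :
  is_ground_state_profile Q -> Derive Q 0 = 0.
Proof.
  intros (even & _ & dQ & _).
  assert (E : Derive (fun t => Q (- t)) 0 = - Derive Q 0).
  { apply is_derive_unique; auto_derive.
    - apply dQ.
    - rewrite Ropp_0; change (Derive (fun x => Q x) 0) with (Derive Q 0); ring. }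
  rewrite (Derive_ext (fun t => Q (- t)) Q 0 even) in E; lra.
Qed.

Lemma profile_eventually_small (Q : R -> R) (e : R) :
  is_ground_state_profile Q -> 0 < e -> exists T, 0 < T /\ forall t, T < t -> Q t < e.
Proof.
  intros (_ & pos & _ & _ & _ & lim) e0.
  apply is_lim_spec in lim; destruct (lim (mkposreal e e0)) as [T HT].
  exists (Rmax 1 T).
  assert (M := Rmax_l 1 T); assert (M' := Rmax_r 1 T).
  split; [lra|]; intros t Ht.
  assert (A : Rabs (Q t - 0) < e) by (apply HT; lra).
  apply Rabs_def2 in A; lra.
Qed.

(** The damping term dissipates this energy at rate [2 / t * Q'^2]. A negative value would therefore
    persist, while the potential part tends to 0 with [Q]. *)
Lemma profile_energy_ge0 (Q : R -> R) :
  is_ground_state_profile Q -> forall t, 0 <= t ->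
  0 <= Derive Q t ^ 2 / 2 - Q t ^ 2 / 2 + Q t ^ 4 / 4.
Proof.
  intros HQ t t0.
  assert (H := HQ); destruct H as (_ & pos & dQ & ddQ & _).
  set (E := fun t => - (Derive Q t ^ 2 / 2 - Q t ^ 2 / 2 + Q t ^ 4 / 4)).
  assert (dE : forall t, is_derive E t
    (- (Derive Q t * (Derive (Derive Q) t - Q t + Q t ^ 3)))).
  { intros s; unfold E; auto_derive.
    - repeat split; [apply ddQ | apply dQ | apply dQ].
    - change (Derive (fun x => Q x) s) with (Derive Q s).
      change (Derive (fun x => Derive Q x) s) with (Derive (Derive Q) s).
      field. }
  assert (mono : forall s, t <= s -> E t <= E s).
  { intros s ts; apply le_of_Derive_ge0; [assumption| |].
    - intros r; eexists; apply dE.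
    - intros r Hr; rewrite (is_derive_unique _ _ _ (dE r)).
      rewrite (profile_ode Q HQ r) by lra.
      replace (- _) with (2 / r * Derive Q r ^ 2) by ring.
      apply Rmult_le_pos; [|apply pow2_ge_0].
      apply Rlt_le, Rdiv_lt_0_compat; lra. }
  apply Rnot_lt_le; intros neg.
  set (e := E t) in *.
  assert (e0 : 0 < e) by (unfold e, E; lra).
  (* Once [Q s < 1] and [Q s < e], one gets [E s <= Q s ^ 2 / 2 < e], against [e <= E s]. *)
  destruct (profile_eventually_small Q (Rmin 1 e) HQ) as [T [T0 HT]];
    [apply Rmin_pos; lra|].
  set (s := Rmax t T + 1).
  assert (M := Rmax_l t T); assert (M' := Rmax_r t T).
  assert (small : Q s < Rmin 1 e) by (apply HT; unfold s; lra).
  assert (N := Rmin_l 1 e); assert (N' := Rmin_r 1 e).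
  assert (le : e <= E s) by (apply mono; unfold s; lra).
  unfold E in le; assert (P := pos s).
  assert (0 <= Derive Q s ^ 2) by apply pow2_ge_0.
  assert (0 <= Q s ^ 4) by (apply pow_le; lra).
  nra.
Qed.

Lemma profile_Derive_lt0 (Q : R -> R) :
  is_ground_state_profile Q -> forall t, 0 < t -> Derive Q t < 0.
Proof.
  intros HQ t t0.
  assert (H := HQ); destruct H as (_ & pos & dQ & ddQ & _).
  assert (crit : forall s, 0 <= s -> Derive Q s = 0 -> 1 < Q s).
  { intros s s0 D; assert (E := profile_energy_ge0 Q HQ s s0).
    rewrite D in E; assert (P := pos s).
    assert (0 < Q s ^ 2) by (apply pow_lt; lra).
    replace (Q s ^ 4) with (Q s ^ 2 * Q s ^ 2) in E by ring.
    assert (2 <= Q s ^ 2) by nra; nra. }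
  (* The equation is singular at 0, where [Q'] vanishes, so [neg_persists] is started at a small
     [a > 0] instead. *)
  assert (start : exists a, 0 < a < t /\ Derive Q a < 0).
  { assert (cQ : continuity_pt Q 0)
      by (apply continuity_pt_filterlim; apply (ex_derive_continuous Q 0 (dQ 0))).
    assert (Q0 := crit 0 (Rle_refl 0) (profile_Derive_0 Q HQ)).
    destruct (cQ (Q 0 - 1)) as [d [d0 Hd]]; [lra|].
    set (a := Rmin d t / 2).
    assert (M := Rmin_l d t); assert (M' := Rmin_r d t).
    assert (0 < Rmin d t) by (apply Rmin_pos; lra).
    assert (a0 : 0 < a) by (unfold a; lra).
    exists a; split; [unfold a; lra|].
    (* Divergence form of the equation: [(s^2 Q')' = s^2 (Q - Q^3)], which is negative near 0
       because [Q 0 > 1]. *)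
    set (g := fun s => - (s ^ 2 * Derive Q s)).
    assert (dg : forall s, is_derive g s
      (- (2 * s * Derive Q s + s ^ 2 * Derive (Derive Q) s))).
    { intros s; unfold g; auto_derive.
      - apply ddQ.
      - change (Derive (fun x => Derive Q x) s) with (Derive (Derive Q) s); ring. }
    assert (lt : g 0 < g a).
    { apply lt_of_Derive_gt0; [assumption| |].
      - intros s; eexists; apply dg.
      - intros s Hs; rewrite (is_derive_unique _ _ _ (dg s)).
        rewrite (profile_ode Q HQ s) by lra.
        replace (- _) with (s ^ 2 * (Q s * (Q s ^ 2 - 1))) by (field; lra).
        assert (A : Rabs (Q s - Q 0) < Q 0 - 1).
        { apply Hd; split; [split; [exact I|lra]|].
          simpl; unfold R_dist; apply Rabs_def1; unfold a in Hs; lra. }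
        apply Rabs_def2 in A.
        apply Rmult_lt_0_compat; [apply pow_lt; lra|].
        apply Rmult_lt_0_compat; [apply pos|nra]. }
    unfold g in lt; assert (0 < a ^ 2) by (apply pow_lt; lra); nra. }
  destruct start as [a [Ha Da]].
  apply (neg_persists (Derive Q) a); [assumption| |lra|lra].
  intros s Hs D; rewrite (profile_ode Q HQ s), D by lra.
  assert (Q1 := crit s ltac:(lra) D); assert (1 < Q s ^ 2) by nra; nra.
Qed.

(** * The function [u = t Q]: its equation, its energy and its maximum *)

Lemma is_derive_tQ (Q : R -> R) :
  is_ground_state_profile Q -> forall t,
  is_derive (fun s => s * Q s) t (Q t + t * Derive Q t).
Proof.
  intros (_ & _ & dQ & _) t; auto_derive.
  - apply dQ.
  - change (Derive (fun x => Q x) t) with (Derive Q t); ring.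
Qed.

Lemma is_derive_tQ' (Q : R -> R) :
  is_ground_state_profile Q -> forall t,
  is_derive (fun s => Q s + s * Derive Q s) t
    (2 * Derive Q t + t * Derive (Derive Q) t).
Proof.
  intros (_ & _ & dQ & ddQ & _) t; auto_derive.
  - repeat split; [apply dQ | apply ddQ].
  - change (Derive (fun x => Q x) t) with (Derive Q t).
    change (Derive (fun x => Derive Q x) t) with (Derive (Derive Q) t); ring.
Qed.

Lemma profile_tQ'' (Q : R -> R) :
  is_ground_state_profile Q -> forall t, 0 < t ->
  2 * Derive Q t + t * Derive (Derive Q) t = t * Q t * (1 - Q t ^ 2).
Proof.
  intros HQ t t0; rewrite (profile_ode Q HQ t t0); field; lra.
Qed.

(* If [u >= e] near infinity, then [u'' >= e / 2] there and [u] grows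
   quadratically, against [u <= t]. *)
Lemma profile_tQ_small (Q : R -> R) (e T : R) :
  is_ground_state_profile Q -> 0 < e -> exists s, T < s /\ s * Q s < e.
Proof.
  intros HQ e0.
  assert (H := HQ); destruct H as (_ & pos & _).
  destruct (profile_eventually_small Q (1 / 2) HQ) as [T1 [T10 HT1]]; [lra|].
  set (T2 := Rmax T T1 + 1).
  assert (M : T < T2) by (assert (M := Rmax_l T T1); unfold T2; lra).
  assert (M' : T1 < T2) by (assert (M' := Rmax_r T T1); unfold T2; lra).
  set (u1 := fun s => Q s + s * Derive Q s).
  (* The length [w] is such that the quadratic gain [e / 4 * w ^ 2] outweighs both the initial
     slope, at worst [- Rabs (u1 T2) * w], and the upper bound [T2 + w] for [u] at the right end. *)
  set (w := 4 / e * (1 + Rabs (u1 T2) + T2) + 1).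
  assert (A := Rabs_pos (u1 T2)); assert (A' := Rle_abs (- u1 T2)).
  rewrite Rabs_Ropp in A'.
  assert (w1 : 1 < w).
  { assert (0 < 4 / e) by (apply Rdiv_lt_0_compat; lra).
    unfold w; nra. }
  assert (ew : e / 4 * w = 1 + Rabs (u1 T2) + T2 + e / 4) by (unfold w; field; lra).
  destruct (Rlt_or_le ((T2 + w) * Q (T2 + w)) e) as [|big];
    [exists (T2 + w); lra|].
  assert (dec : (exists s, T2 < s < T2 + w /\ s * Q s < e) \/
                (forall s, T2 < s < T2 + w -> e <= s * Q s)).
  { destruct (classic (exists s, T2 < s < T2 + w /\ s * Q s < e))
      as [|no]; [left; assumption|right].
    intros s Hs; apply Rnot_lt_le; intros lt; apply no; exists s; lra. }
  destruct dec as [[s [Hs lt]] | large]; [exists s; lra|exfalso].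
  (* Beyond [T2], [Q < 1/2] gives [1 - Q^2 > 1/2], hence [u'' >= e / 2]; one integration bounds
     [u'], a second one bounds [u]. *)
  assert (slope : forall s, T2 <= s <= T2 + w -> u1 T2 + e / 2 * (s - T2) <= u1 s).
  { intros s Hs.
    set (f := fun r => u1 r - e / 2 * r).
    assert (df : forall r, is_derive f r
      (2 * Derive Q r + r * Derive (Derive Q) r - e / 2)).
    { intros r; unfold f.
      apply (is_derive_minus (V := R_NormedModule) u1 (fun r => e / 2 * r)).
      - apply is_derive_tQ'; assumption.
      - auto_derive; [exact I | ring]. }
    assert (f T2 <= f s); [|unfold f in *; lra].
    apply le_of_Derive_ge0; [lra| |].
    - intros r; eexists; apply df.
    - intros r Hr; rewrite (is_derive_unique _ _ _ (df r)).
      rewrite (profile_tQ'' Q HQ r) by lra.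
      assert (Q r < 1 / 2) by (apply HT1; lra).
      assert (L := large r ltac:(lra)); assert (P := pos r).
      assert (Q r ^ 2 < 1 / 2) by nra; nra. }
  set (f := fun r => r * Q r - (u1 T2 * r + e / 4 * (r - T2) ^ 2)).
  assert (df : forall r, is_derive f r (u1 r - u1 T2 - e / 2 * (r - T2))).
  { intros r; unfold f.
    replace (u1 r - u1 T2 - e / 2 * (r - T2))
      with (u1 r - (u1 T2 + e / 2 * (r - T2))) by ring.
    apply (is_derive_minus (V := R_NormedModule) (fun r => r * Q r)
      (fun r => u1 T2 * r + e / 4 * (r - T2) ^ 2)).
    - apply is_derive_tQ; assumption.
    - auto_derive; [exact I | field]. }
  assert (growth : f T2 <= f (T2 + w)).
  { apply le_of_Derive_ge0; [lra| |].
    - intros r; eexists; apply df.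
    - intros r Hr; rewrite (is_derive_unique _ _ _ (df r)).
      specialize (slope r ltac:(lra)); lra. }
  unfold f in growth.
  replace (T2 + w - T2) with w in growth by ring.
  assert (Q (T2 + w) < 1 / 2) by (apply HT1; lra).
  assert (P := pos T2).
  assert (0 < T2 * Q T2) by (apply Rmult_lt_0_compat; lra).
  assert ((T2 + w) * Q (T2 + w) <= T2 + w) by nra.
  assert (e / 4 * w ^ 2 = (1 + Rabs (u1 T2) + T2 + e / 4) * w)
    by (rewrite <- ew; ring).
  nra.
Qed.

(** This energy decreases at the strict rate [t Q^4 / 2], and it is nonnegative since [u] takes
    arbitrarily small values far out. Comparing [t] with [t + 1] makes the bound strict. *)
Lemma profile_tQ_energy_gt0 (Q : R -> R) :
  is_ground_state_profile Q -> forall t, 0 <= t ->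
  0 < (Q t + t * Derive Q t) ^ 2 / 2 - t ^ 2 * Q t ^ 2 / 2 + t ^ 2 * Q t ^ 4 / 4.
Proof.
  intros HQ t t0.
  assert (H := HQ); destruct H as (_ & pos & dQ & ddQ & _).
  set (E := fun t => - ((Q t + t * Derive Q t) ^ 2 / 2
                        - t ^ 2 * Q t ^ 2 / 2 + t ^ 2 * Q t ^ 4 / 4)).
  assert (dE : forall s, is_derive E s
    (- ((Q s + s * Derive Q s) *
          (2 * Derive Q s + s * Derive (Derive Q) s - s * Q s)
        + s * Q s ^ 4 / 2 + s ^ 2 * Q s ^ 3 * Derive Q s))).
  { intros s; unfold E; auto_derive.
    - repeat split; first [apply ddQ | apply dQ].
    - change (Derive (fun x => Q x) s) with (Derive Q s).
      change (Derive (fun x => Derive Q x) s) with (Derive (Derive Q) s).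
      field. }
  assert (pos' : forall s, 0 < s -> 0 < Derive E s).
  { intros s s0; rewrite (is_derive_unique _ _ _ (dE s)).
    rewrite (profile_tQ'' Q HQ s s0).
    replace (- _) with (s * Q s ^ 4 / 2) by field.
    assert (P := pow_lt (Q s) 4 (pos s)); nra. }
  assert (lt : E t < E (t + 1)).
  { apply lt_of_Derive_gt0; [lra| |].
    - intros r; eexists; apply dE.
    - intros r Hr; apply pos'; lra. }
  assert (le : E (t + 1) <= 0).
  { apply Rnot_lt_le; intros e0; set (e := E (t + 1)) in *.
    destruct (profile_tQ_small Q (Rmin 1 e) (t + 1) HQ) as [s [ts small]];
      [apply Rmin_pos; lra|].
    assert (N := Rmin_l 1 e); assert (N' := Rmin_r 1 e).
    assert (le : e <= E s).
    { apply le_of_Derive_ge0; [lra| |].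
      - intros r; eexists; apply dE.
      - intros r Hr; apply Rlt_le, pos'; lra. }
    unfold E in le.
    assert (0 <= (Q s + s * Derive Q s) ^ 2) by apply pow2_ge_0.
    assert (0 <= s ^ 2 * Q s ^ 4)
      by (apply Rmult_le_pos; apply pow_le; [lra | apply Rlt_le, pos]).
    assert (0 < s * Q s) by (apply Rmult_lt_0_compat; [lra | apply pos]).
    replace (s ^ 2 * Q s ^ 2) with ((s * Q s) ^ 2) in le by ring.
    nra. }
  unfold E in lt, le; lra.
Qed.

Lemma profile_tQ_max (Q : R -> R) :
  is_ground_state_profile Q -> exists t0,
  0 < t0 /\ Q t0 + t0 * Derive Q t0 = 0 /\
  (forall t, 0 < t < t0 -> 0 < Q t + t * Derive Q t) /\
  (forall t, 0 < t -> t * Q t <= t0 * Q t0).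
Proof.
  intros HQ.
  assert (H := HQ); destruct H as (_ & pos & _).
  set (u := fun s => s * Q s).
  set (u1 := fun s => Q s + s * Derive Q s).
  assert (du : forall t, is_derive u t (u1 t)) by (apply is_derive_tQ, HQ).
  assert (du1 : forall t, is_derive u1 t
    (2 * Derive Q t + t * Derive (Derive Q) t)) by (apply is_derive_tQ', HQ).
  assert (exu1 : forall t, ex_derive u1 t) by (intros t; eexists; apply du1).
  assert (exu : forall t, ex_derive u t) by (intros t; eexists; apply du).
  assert (crit : forall t, 0 < t -> u1 t = 0 -> Derive u1 t < 0).
  { intros t t0 D; rewrite (is_derive_unique _ _ _ (du1 t)).
    rewrite (profile_tQ'' Q HQ t t0).
    assert (E := profile_tQ_energy_gt0 Q HQ t ltac:(lra)).
    fold (u1 t) in E; rewrite D in E.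
    assert (P := pos t).
    assert (0 < t ^ 2 * Q t ^ 2)
      by (apply Rmult_lt_0_compat; apply pow_lt; lra).
    assert (0 < (t ^ 2 * Q t ^ 2) * (Q t ^ 2 - 2)) by nra.
    assert (2 < Q t ^ 2) by nra.
    assert (0 < t * Q t) by (apply Rmult_lt_0_compat; lra).
    nra. }
  (* Some [s > 1] has [u s < u 1], so the mean value theorem yields a point of negative slope. *)
  assert (desc : exists T, 0 < T /\ u1 T < 0).
  { destruct (profile_tQ_small Q (u 1) 1 HQ) as [s [s1 small]];
      [unfold u; assert (P := pos 1); lra|].
    destruct (ex_derive_increment u 1 s s1 exu) as [c [Ec Hc]].
    rewrite (is_derive_unique _ _ _ (du c)) in Ec.
    fold (u s) in small.
    exists c; split; [lra|nra]. }
  destruct desc as [T [T0 uT]].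
  destruct (IVT (fun s => - u1 s) 0 T) as [t0 [Ht0 Et0]].
  - intros t; apply continuity_pt_opp.
    apply continuity_pt_filterlim; apply (ex_derive_continuous u1 t (exu1 t)).
  - assumption.
  - unfold u1; assert (P := pos 0); lra.
  - lra.
  - assert (z0 : u1 t0 = 0) by lra.
    assert (t0pos : 0 < t0).
    { destruct Ht0 as [[lt | <-] _]; [assumption|].
      unfold u1 in z0; assert (P := pos 0); lra. }
    assert (after : forall t, t0 < t -> u1 t < 0).
    { apply neg_persists; [assumption| |lra].
      intros t Ht; apply crit; lra. }
    (* A nonpositive slope before [t0] would stay negative up to [t0], where the slope is zero. *)
    assert (before : forall t, 0 < t < t0 -> 0 < u1 t).
    { intros t Ht; apply Rnot_le_lt; intros neg.
      assert (u1 t0 < 0); [|lra].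
      apply (neg_persists u1 t); [assumption| |assumption|lra].
      intros s Hs; apply crit; lra. }
    exists t0; repeat split; [assumption|assumption|assumption|].
    intros t tpos; fold (u t); fold (u t0).
    destruct (Rle_or_lt t t0) as [le | lt].
    + apply le_of_Derive_ge0; [assumption|assumption|].
      intros s Hs; rewrite (is_derive_unique _ _ _ (du s)).
      apply Rlt_le, before; lra.
    + destruct (ex_derive_increment u t0 t lt exu) as [c [Ec Hc]].
      rewrite (is_derive_unique _ _ _ (du c)) in Ec.
      specialize (after c ltac:(lra)); nra.
Qed.

(** * The barrier *)

(* The terms of degree at most two are those of the expansion of [x] in
   [(z, tau)] on the unstable manifold of the origin; the cubic terms are chosen
   so that the field points into [x <= barrier z tau] for [0 <= z <= 1]. *)
Definition barrier (z tau : R) : R :=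
  tau + 3 * z - 9 / 5 * z ^ 2 + 1 / 5 * z ^ 3 - 2 / 5 * z * tau
  - 1 / 10 * z ^ 2 * tau.

(** Along the orbit the gap [X - x] satisfies a linear differential inequality and vanishes at
    [t = 0], so the Gronwall lemma keeps it nonnegative. *)
Lemma profile_below_barrier (Q : R -> R) (b : R) :
  is_ground_state_profile Q -> 0 < b ->
  (forall t, 0 < t < b -> 0 < Q t + t * Derive Q t) ->
  (b * Q b) ^ 2 <= barrier (- (b * Derive Q b / Q b)) (b ^ 2).
Proof.
  intros HQ b0 incr.
  assert (H := HQ); destruct H as (_ & pos & dQ & ddQ & _).
  assert (nz : forall t, Q t <> 0) by (intros t; specialize (pos t); lra).
  (* Here [y = z / t]; unlike [z / t], this quotient makes sense at [t = 0], and it solves a Riccati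
     equation. *)
  set (y := fun t => - (Derive Q t / Q t)).
  assert (dy : forall t, is_derive y t (- (Derive (Derive Q) t / Q t) + y t ^ 2)).
  { intros t; unfold y; auto_derive.
    - repeat split; [apply ddQ | apply dQ | apply nz].
    - change (Derive (fun x => Q x) t) with (Derive Q t).
      change (Derive (fun x => Derive Q x) t) with (Derive (Derive Q) t).
      field; apply nz. }
  assert (exy : forall t, ex_derive y t) by (intros t; eexists; apply dy).
  (* In the time [ln t] the gap has linear rate -1 at the origin, a singular coefficient [- 1 / t]
     in the variable [t]. The factor [t] cancels it. *)
  set (F := fun t => t * (barrier (t * y t) (t ^ 2) - (t * Q t) ^ 2)).
  (* Substituting [x = X - gap], the gap enters its own [ln t] derivative with coefficient
     [2 (1 - z) - dX/dz], which equals [t k - 1]. *)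
  set (k := fun t => 8 / 5 * y t - 3 / 5 * t * y t ^ 2 + 2 / 5 * t + 1 / 5 * t ^ 2 * y t).
  assert (ck : forall t, continuous k t).
  { intros t; apply (ex_derive_continuous k); unfold k; auto_derive.
    repeat split; apply exy. }
  assert (dF : forall t, is_derive F t
    (let z := t * y t in let z' := y t + t * Derive y t in
     barrier z (t ^ 2) - (t * Q t) ^ 2 +
     t * ((3 - 18 / 5 * z + 3 / 5 * z ^ 2 - 2 / 5 * t ^ 2 - 1 / 5 * z * t ^ 2) * z'
          + (1 - 2 / 5 * z - 1 / 10 * z ^ 2) * (2 * t)
          - 2 * t * Q t * (Q t + t * Derive Q t)))).
  { intros t; unfold F, barrier; auto_derive.
    - repeat split; first [apply exy | apply dQ].
    - change (Derive (fun x => Q x) t) with (Derive Q t).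
      change (Derive (fun x => y x) t) with (Derive y t).
      field. }
  assert (Fb : 0 <= F b).
  { apply (linear_gronwall_ge0 F k b); [lra | | |assumption|].
    - unfold F; ring.
    - intros t; eexists; apply dF.
    - intros t Ht.
      rewrite (is_derive_unique _ _ _ (dF t)); cbv zeta.
      rewrite (is_derive_unique _ _ _ (dy t)).
      rewrite (profile_ode Q HQ t) by lra.
      assert (EQ : Derive Q t = - y t * Q t) by (unfold y; field; apply nz).
      rewrite EQ.
      assert (P := pos t).
      assert (y0 : 0 < y t).
      { assert (D := profile_Derive_lt0 Q HQ t ltac:(lra)).
        rewrite EQ in D; nra. }
      assert (z1 : t * y t < 1).
      { specialize (incr t Ht); rewrite EQ in incr; nra. }
      set (z := t * y t) in *.
      assert (z0 : 0 < z) by (apply Rmult_lt_0_compat; lra).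
      assert (Et : y t = z / t) by (unfold z; field; lra).
      apply Rminus_le_0; unfold F, k, barrier; fold z; rewrite Et.
      assert (tau : 0 < t ^ 2) by (apply pow_lt; lra).
      (* With the multiple of [F] removed, [x] drops out. What remains is the [ln t] derivative of
         the gap on the surface [x = X], a polynomial in [z] and [tau] written as a sum of terms
         nonnegative for [0 <= z <= 1]. *)
      match goal with |- 0 <= ?e => replace e with
        (z * (z ^ 2 * (1 - z) * (17 / 25 - 3 / 25 * z)
              + z * t ^ 2 * (13 / 50 - 1 / 10 * z ^ 2)
              + (t ^ 2) ^ 2 * (4 / 25 + 3 / 25 * z + 1 / 50 * z ^ 2)))
        by (field; lra) end.
      assert (0 <= z ^ 2 * (1 - z) * (17 / 25 - 3 / 25 * z))
        by (apply Rmult_le_pos; [apply Rmult_le_pos|]; [apply pow2_ge_0|lra|lra]).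
      assert (0 <= z * t ^ 2 * (13 / 50 - 1 / 10 * z ^ 2))
        by (apply Rmult_le_pos; [apply Rmult_le_pos|]; [lra|lra|nra]).
      assert (0 <= (t ^ 2) ^ 2 * (4 / 25 + 3 / 25 * z + 1 / 50 * z ^ 2))
        by (apply Rmult_le_pos; [apply pow2_ge_0|nra]).
      apply Rmult_le_pos; lra. }
  unfold F in Fb.
  replace (- (b * Derive Q b / Q b)) with (b * y b) by (unfold y; field; apply nz).
  nra.
Qed.

(** * The numerical bound at the maximum of [u] *)

Theorem lemma5p1 (Q : R -> R) (HQ : is_ground_state_profile Q) :
  forall t : R, 0 < t -> 3 * (Q t) ^ 2 < (6 - / 10 ^ 20) / t ^ 2.
Proof.
  intros t t_gt0.
  assert (H := HQ); destruct H as (_ & pos & _).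
  destruct (profile_tQ_max Q HQ) as [t0 [t0_gt0 [crit [incr max]]]].
  assert (below := profile_below_barrier Q t0 HQ t0_gt0 incr).
  assert (energy := profile_tQ_energy_gt0 Q HQ t0 ltac:(lra)).
  assert (P := pos t0).
  replace (- (t0 * Derive Q t0 / Q t0)) with 1 in below.
  2:{ replace (t0 * Derive Q t0) with (- Q t0) by lra; field; lra. }
  unfold barrier in below.
  rewrite crit in energy.
  assert (0 < Q t0 ^ 2) by (apply pow_lt; lra).
  assert (tau : 2 * t0 ^ 2 < (t0 * Q t0) ^ 2).
  { assert (0 < t0 ^ 2) by (apply pow_lt; lra).
    assert (0 < (t0 ^ 2 * Q t0 ^ 2) * (Q t0 ^ 2 - 2)) by nra.
    assert (0 < t0 ^ 2 * Q t0 ^ 2) by (apply Rmult_lt_0_compat; lra).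
    assert (2 < Q t0 ^ 2) by nra; nra. }
  (* Inserting [tau < x / 2] into [x <= 7/5 + tau/2] gives [3/4 x < 7/5]. *)
  assert (bound : (t0 * Q t0) ^ 2 < 28 / 15) by lra.
  specialize (max t t_gt0).
  assert (0 < t * Q t) by (apply Rmult_lt_0_compat; [lra | apply pos]).
  assert (lt : (t * Q t) ^ 2 < 28 / 15) by nra.
  assert (t2 : 0 < t ^ 2) by (apply pow_lt; lra).
  (* Since [3 * 28/15 = 28/5], the margin below 6 is [2/5], so this crude estimate suffices. *)
  assert (small : / 10 ^ 20 < / 10) by (apply Rinv_lt_contravar; simpl; lra).
  apply Rmult_lt_reg_r with (t ^ 2); [assumption|].
  replace ((6 - / 10 ^ 20) / t ^ 2 * t ^ 2) with (6 - / 10 ^ 20)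
    by (unfold Rdiv; rewrite Rmult_assoc, Rinv_l by lra; ring).
  replace (3 * Q t ^ 2 * t ^ 2) with (3 * (t * Q t) ^ 2) by ring.
  lra.
Qed.
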